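(* Let $N,s,m$ be positive integers, let $n=Ns$, and let $y_1,\dots,y_m\in\mathbb{C}^n$ be centred data vectors, i.e. $\sum_{i=1}^m y_i=\mathbf{0}$. Write $\hat{y}_i=\mathcal{F}(y_i)$ and $\hat{e}_{js}=\mathcal{F}(e_{js})$. For each $t\in\{0,1,\dots,N-1\}$ let $\hat{q}^{(1)}_{t+\langle N\rangle}$ be any solution of $$\hat{q}^{(1)}_{t+\langle N\rangle}\in\arg\max_{\substack{\hat{q}\in\mathbb{C}^{t+\langle N\rangle}\\ \|\hat{q}\|^2=\frac1N}}\ \sum_{i=1}^m\sum_{j=0}^{N-1}\left|\left\langle(\sqrt{n}\,\hat{y}_i\hat{e}_{js})_{t+\langle N\rangle},\hat{q}\right\rangle\right|^2 ,$$ equivalently $\hat{q}^{(1)}_{t+\langle N\rangle}=\frac{1}{\sqrt N}\,p_t$, where $p_t$ solves the standard PCA problem on $Nm$ data vectors in the $s$-dimensional space $\mathbb{C}^{t+\langle N\rangle}$, $$p_t\in\arg\max_{\substack{\hat{q}\in\mathbb{C}^{t+\langle N\rangle}\\ \|\hat{q}\|^2=1}}\ \sum_{i=1}^m\sum_{j=0}^{N-1}\left|\left\langle(\hat{y}_i\hat{e}_{js})_{t+\langle N\rangle},\hat{q}\right\rangle\right|^2 .$$ Set $$\hat{q}^{(1)}=\sum_{t=0}^{N-1}\hat{q}^{(1)}_{t+\langle N\rangle},\qquad q^{(1)}=\mathcal{F}^{-1}\big(\hat{q}^{(1)}\big).$$ Then $q^{(1)}$ is a first $s$-quasicyclic principal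 component of $\{y_1,\dots,y_m\}$, that is, $q^{(1)}\in Q^n(s)$ and $$q^{(1)}\in\arg\max_{q\in Q^n(s)}\ \sum_{i=1}^m\left\|\mathsf{proj}_{\mathsf{span}^s(q)}(y_i)\right\|^2 .$$
   Context: Signals are elements of $\mathbb{C}^n$, with entries indexed from $0$ to $n-1$ and indices read modulo $n$. The inner product is $\langle x,y\rangle=\sum_{i=0}^{n-1}x(i)y^*(i)$ (where $^*$ is complex conjugation), and $\|x\|=\sqrt{\langle x,x\rangle}$. Products of signals are pointwise: $(xy)(i)=x(i)y(i)$. $e_j$ denotes the $j$th standard basis vector (index modulo $n$) and $\circledast$ is circular convolution, so $x\circledast e_j$ is the circular shift $(x\circledast e_j)(i)=x(i-j)$. Autocorrelation: $R_x(j)=\langle x,x\circledast e_j\rangle=\sum_{i=0}^{n-1}x(i)x^*(i-j)$ for $0\le j<n$. With $n=Ns$, a signal $x\in\mathbb{C}^n$ is $s$-quasicyclic shift-orthonormal if $R_x(0)=1$ and $R_x(ks)=0$ for every integer $k$ with $ks\not\equiv 0 \pmod n$. $Q^n(s)\subseteq\mathbb{C}^n$ is the set of all such signals. For $q\in Q^n(s)$, $\mathsf{span}^s(q)=\mathrm{span}\{q\circledast e_{ks}: 0\le k<N\}$. For a subspace $V\subseteq\mathbb{C}^n$, $\mathsf{proj}_V$ is the orthogonal projection onto $V$. Discrete Fourier transform: with $\omega_n=e^{2\pi\mathbf{i}/n}$, $\mathcal{F}(x)=\hat{x}$ where $\hat{x}(k)=\frac{1}{\sqrt n}\sum_{i=0}^{n-1}x(i)\omega_n^{-ik}$;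 its inverse is $x(i)=\frac{1}{\sqrt n}\sum_{k=0}^{n-1}\hat{x}(k)\omega_n^{ik}$. For $0\le t<N$, $t+\langle N\rangle=\{t,t+N,\dots,t+(s-1)N\}\subseteq\{0,\dots,n-1\}$; $\mathbb{C}^{t+\langle N\rangle}$ is the $s$-dimensional subspace of $\mathbb{C}^n$ of signals supported on the indices in $t+\langle N\rangle$; and for $z\in\mathbb{C}^n$, $z_{t+\langle N\rangle}$ denotes the orthogonal projection of $z$ onto $\mathbb{C}^{t+\langle N\rangle}$ (entries outside $t+\langle N\rangle$ set to $0$). *)

(* Defs.v *)
From HB Require Import structures.
From mathcomp Require Import all_boot all_order all_algebra.
From mathcomp Require Import sesquilinear spectral.
From mathcomp Require Import complex.
From mathcomp Require Import reals trigo.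

Set Implicit Arguments.
Unset Strict Implicit.
Unset Printing Implicit Defensive.

Import Order.TTheory GRing.Theory Num.Theory.
Local Open Scope ring_scope.

(* Signals are row vectors 'rV[R[i]]_n. The library's norm on row vectors is
   the sup norm; the Hermitian norm is [l2norm] below. Norms, moduli and the
   objective functions take values in R[i]; they are real, and on real elements
   the (partial) order of R[i] is the usual one. *)

Definition dot {R : realType} {n : nat} (x y : 'rV[R[i]]_n) : R[i] :=
  dotmx x y.

Lemma dotE {R : realType} {n : nat} (x y : 'rV[R[i]]_n) :
  dot x y = \sum_(i < n) x 0 i * (y 0 i)^*.
Proof.
rewrite /dot dotmxE mxE; apply: eq_bigr => i _.
by rewrite !mxE.
Qed.

Definition l2norm {R : realType} {n : nat} (x : 'rV[R[i]]_n) : R[i] :=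
  sqrtC (dot x x).

Definition pointwise {R : realType} {n : nat} (x y : 'rV[R[i]]_n) :
  'rV[R[i]]_n := map2_mx *%R x y.

(* z mod n as an element of 'I_n; [i0] only witnesses that 'I_n is inhabited. *)
Definition index_mod {n : nat} (i0 : 'I_n) (z : int) : 'I_n :=
  insubd i0 `|(z %% n%:Z)%Z|%N.

Lemma index_modE {n : nat} (i0 : 'I_n) (z : int) :
  (index_mod i0 z)%:Z = (z %% n%:Z)%Z.
Proof.
have n0 : n%:Z != 0 by case: n i0 => [[]|].
have z0 : 0 <= (z %% n%:Z)%Z by rewrite modz_ge0.
rewrite /index_mod val_insubd ifT ?gez0_abs//.
by rewrite -ltz_nat gez0_abs// ltz_pmod// lt0r n0.
Qed.

Definition std_basis {R : realType} {n : nat} (j : int) : 'rV[R[i]]_n :=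
  \row_(i < n) (i%:Z == j %[mod n%:Z])%Z%:R.

Definition circ_conv {R : realType} {n : nat} (x y : 'rV[R[i]]_n) :
  'rV[R[i]]_n :=
  \row_(i < n) \sum_(k < n) x 0 k * y 0 (index_mod i (i%:Z - k%:Z)).

Definition shift {R : realType} {n : nat} (x : 'rV[R[i]]_n) (j : int) :
  'rV[R[i]]_n := circ_conv x (std_basis j).

Lemma shiftE {R : realType} {n : nat} (x : 'rV[R[i]]_n) (j : int) (i : 'I_n) :
  shift x j 0 i = x 0 (index_mod i (i%:Z - j)).
Proof.
have e (k : 'I_n) : (k == index_mod i (i%:Z - j)) =
    ((index_mod i (i%:Z - k%:Z))%:Z == j %[mod n%:Z])%Z.
  rewrite -val_eqE /= -eqz_nat !index_modE modz_mod.
  rewrite -{1}(@modz_small k n) ?ltz_nat ?ltn_ord//.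
  by rewrite !eqz_mod_dvd -[LHS]rpredN opprB addrAC.
rewrite mxE (bigD1 (index_mod i (i%:Z - j)))//= big1 ?addr0 => [|k].
  by rewrite mxE -e eqxx mulr1.
by rewrite mxE -e => /negPf ->; rewrite mulr0.
Qed.

Definition autocorr {R : realType} {n : nat} (x : 'rV[R[i]]_n) (j : int) :
  R[i] := dot x (shift x j).

(* the set Q^n(s) *)
Definition quasicyclic_shift_orthonormal {R : realType} {n : nat} (s : nat)
    (x : 'rV[R[i]]_n) : Prop :=
  autocorr x 0 = 1 /\
  forall k : int, ~ (k * s%:Z = 0 %[mod n%:Z])%Z -> autocorr x (k * s%:Z) = 0.

(* span^s(q), as the row space of the matrix of the N shifts of q by ks *)
Definition shift_span {R : realType} {n : nat} (N s : nat)
    (q : 'rV[R[i]]_n) : 'M[R[i]]_(N, n) :=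
  \matrix_(k < N) shift q (k%:Z * s%:Z).

(* orthogonal projection of x onto the row space of V *)
Definition proj {R : realType} {n p : nat} (V : 'M[R[i]]_(p, n))
    (x : 'rV[R[i]]_n) : 'rV[R[i]]_n := x *m proj_ortho V.

(* e^{2 pi i / n} *)
Definition omega (R : realType) (n : nat) : R[i] :=
  Complex (cos (2 * pi / n%:R)) (sin (2 * pi / n%:R)).

Definition dft {R : realType} {n : nat} (x : 'rV[R[i]]_n) : 'rV[R[i]]_n :=
  \row_(k < n) ((sqrtC n%:R)^-1 *
    \sum_(i < n) x 0 i * omega R n ^- (i * k)%N).

Definition idft {R : realType} {n : nat} (x : 'rV[R[i]]_n) : 'rV[R[i]]_n :=
  \row_(i < n) ((sqrtC n%:R)^-1 *
    \sum_(k < n) x 0 k * omega R n ^+ (i * k)%N).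

(* t + <N> = {t, t + N, ..., t + (s-1)N} *)
Definition coset_idx {n : nat} (N s t : nat) : {set 'I_n} :=
  [set i : 'I_n | [exists l : 'I_s, i == t + l * N :> nat]%N].

(* x lies in C^{t+<N>} *)
Definition supported_on {R : realType} {n : nat} (A : {set 'I_n})
    (x : 'rV[R[i]]_n) : Prop := forall i, i \notin A -> x 0 i = 0.

(* z_{t+<N>} *)
Definition restrict {R : realType} {n : nat} (A : {set 'I_n})
    (x : 'rV[R[i]]_n) : 'rV[R[i]]_n :=
  \row_(i < n) if i \in A then x 0 i else 0.

Definition is_argmax {R : realType} {T : Type} (D : T -> Prop) (f : T -> R[i])
    (x : T) : Prop := D x /\ forall y, D y -> f y <= f x.

Definition first_quasicyclic_pc {R : realType} {n m : nat} (N s : nat)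
    (y : 'I_m -> 'rV[R[i]]_n) (q : 'rV[R[i]]_n) : Prop :=
  is_argmax (quasicyclic_shift_orthonormal s)
    (fun q => \sum_(i < m) l2norm (proj (shift_span N s q) (y i)) ^+ 2) q.

(* The problem on C^{t+<N>} solved by the Fourier block of index t. *)
Definition block_argmax {R : realType} {n m : nat} (N s t : nat)
    (y : 'I_m -> 'rV[R[i]]_n) (q : 'rV[R[i]]_n) : Prop :=
  is_argmax
    (fun q => supported_on (coset_idx N s t) q /\ l2norm q ^+ 2 = N%:R^-1)
    (fun q => \sum_(i < m) \sum_(j < N)
       `|dot (restrict (coset_idx N s t)
               (sqrtC n%:R *:
                 pointwise (dft (y i)) (dft (std_basis (j%:Z * s%:Z))))) q|
         ^+ 2) q.

Definition block_pca {R : realType} {n m : nat} (N s t : nat)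
    (y : 'I_m -> 'rV[R[i]]_n) (p : 'rV[R[i]]_n) : Prop :=
  is_argmax
    (fun p => supported_on (coset_idx N s t) p /\ l2norm p ^+ 2 = 1)
    (fun p => \sum_(i < m) \sum_(j < N)
       `|dot (restrict (coset_idx N s t)
               (pointwise (dft (y i)) (dft (std_basis (j%:Z * s%:Z))))) p|
         ^+ 2) p.

(* Main.v *)
Require Import Defs.
From HB Require Import structures.
From mathcomp Require Import all_boot all_order all_algebra.
From mathcomp Require Import sesquilinear spectral.
From mathcomp Require Import complex.
From mathcomp Require Import reals trigo.
From mathcomp Require Import ring.

Set Implicit Arguments.
Unset Strict Implicit.
Unset Printing Implicit Defensive.

Import Order.TTheory GRing.Theory Num.Theory.
Local Open Scope ring_scope.

(** Put [w = e^(2 pi i / n)], [u = w^s] (a primitive [N]th root of unity), and let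
    [g_t(a, z)] be the inner product of [a] and [z] over the frequencies
    [f = t mod N]. Shifting by [k s] multiplies the Fourier coefficient of index
    [f] by [w^(- k s f) = u^(- k t)], which depends only on the block [t] of [f];
    hence
      [<idft a, shift (idft z) (k s)> = sum_t u^(k t) g_t(a, z)].
    For [a = z], Fourier inversion on Z/N shows that [idft z] lies in [Q^n(s)] iff
    [g_t(z, z) = 1/N] for every [t]. In that case the [N] shifts are orthonormal,
    so the squared norm of the projection of [idft a] is the sum over [k] of the
    squared moduli of these inner products, which is [N sum_t |g_t(a, z)|^2] by
    Parseval on Z/N. Both the constraint and the objective thus decouple into the
    block problems. *)

(** * Powers of a primitive root of unity and the Fourier matrix *)

Section RootsOfUnity.
Variables (C : numClosedFieldType) (n : nat) (z : C).
Hypothesis z_prim : n.-primitive_root z.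

Lemma prim_root_neq0 : z != 0.
Proof. by rewrite (prim_root_eq0 z_prim) -lt0n (prim_order_gt0 z_prim). Qed.

Lemma conj_prim_root : z^* = z^-1.
Proof.
have /eqP : `|z| ^+ n = 1 by rewrite -normrX prim_expr_order// normr1.
rewrite pexpr_eq1 ?(prim_order_gt0 z_prim)// => /eqP z1.
by rewrite invC_norm z1 expr1n invr1 mul1r.
Qed.

Lemma conj_prim_rootXz (k : int) : (z ^ k)^* = z ^ (- k).
Proof.
by rewrite rmorphXz ?unitfE ?prim_root_neq0//= conj_prim_root exprz_inv.
Qed.

Lemma prim_rootXz_eq1 (k : int) : (z ^ k == 1) = (n%:Z %| k)%Z.
Proof.
have zX m : (z ^+ m == 1) = (n %| m)%N by rewrite (prim_order_dvd z_prim).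
by case: k => m; rewrite dvdzE/= -?exprnN -?exprnP ?invr_eq1 -zX.
Qed.

Lemma prim_rootXz_mod (k l : int) : (k = l %[mod n])%Z -> z ^ k = z ^ l.
Proof.
move=> /eqP; rewrite eqz_mod_dvd -prim_rootXz_eq1 => /eqP kl.
by rewrite -[k](subrK l) expfzDr ?prim_root_neq0// kl mul1r.
Qed.

(** Orthogonality of characters: if [z ^ k] is not 1, multiplying the geometric sum by [z ^ k - 1]
    telescopes to 0. *)
Lemma sum_prim_rootXz (k : int) :
  \sum_(t < n) z ^ (k * t%:Z) = (n%:Z %| k)%Z%:R * n%:R.
Proof.
under eq_bigr do rewrite -exprz_exp -exprnP.
rewrite -prim_rootXz_eq1; have [|] := boolP (z ^ k == 1).
  move=> /eqP ->; under eq_bigr do rewrite expr1n.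
  by rewrite sumr_const card_ord mul1r.
rewrite -subr_eq0 mul0r => zk1.
apply: (mulfI zk1); rewrite -subrX1 mulr0.
apply/eqP; rewrite subr_eq0 exprnP exprz_exp prim_rootXz_eq1.
exact: dvdz_mull.
Qed.

Lemma ord_dvdz_sub (i j : 'I_n) : (n%:Z %| i%:Z - j%:Z)%Z = (i == j).
Proof.
by rewrite -eqz_mod_dvd !modz_small ?ltz_nat ?ltn_ord.
Qed.

(** Positive exponents: right multiplication is the inverse transform. The root is left general, to
    serve both Z/n and Z/N. *)
Definition fourier_mx : 'M[C]_n :=
  \matrix_(i, k) ((sqrtC n%:R)^-1 * z ^+ (i * k)).

Lemma fourier_mx_unitary : fourier_mx \is unitarymx.
Proof.
have n0 : n%:R != 0 :> C by rewrite pnatr_eq0 -lt0n (prim_order_gt0 z_prim).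
have sn : (sqrtC n%:R : C)^-1 \is Num.real by rewrite rpredV sqrtC_real.
apply/unitarymxP/matrixP => i j; rewrite !mxE.
under eq_bigr => k _.
  rewrite !mxE !exprnP !PoszM [(_ * _)^*]rmorphM/= conj_prim_rootXz mulrACA.
  rewrite conj_Creal//.
  rewrite -invfM -expr2 sqrtCK -expfzDr ?prim_root_neq0//.
  rewrite -mulNr -mulrDl.
  over.
rewrite -mulr_sumr sum_prim_rootXz ord_dvdz_sub mulrCA mulVf//.
by rewrite mulr1.
Qed.

End RootsOfUnity.

(** * Primitivity of e^(2 pi i / n) *)

Lemma omegaX (R : realType) n k :
  omega R n ^+ k = Complex (cos (2 * pi / n%:R *+ k)) (sin (2 * pi / n%:R *+ k)).
Proof.
rewrite /omega; set a : R := 2 * pi / n%:R.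
elim: k => [|k IH]; first by rewrite expr0 mulr0n cos0 sin0.
rewrite exprS IH mulrS cosD sinD; apply/eqP.
by rewrite eq_complex/= eqxx addrC eqxx.
Qed.

(** Half angles: [cos x = 1] would force [sin (x / 2) = 0], but [x / 2] lies strictly between 0 and
    pi. *)
Lemma cos_eq1_lt2pi (R : realType) (x : R) : 0 < x < 2 * pi -> cos x != 1.
Proof.
move=> /andP[x0 x2]; apply/eqP => cx1.
have : 0 < sin (x / 2).
  by rewrite sin_gt0_pi// divr_gt0//= ltr_pdivrMr// mulrC.
move: cx1; rewrite {1}[x](splitr x) -mulr2n cos_mulr2n => cx1.
have := cos2Dsin2 (x / 2).
have -> : cos (x / 2) ^+ 2 = 1.
  apply: (@mulIf _ 2%:R); first by rewrite pnatr_eq0.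
  by rewrite mulr_natr mul1r -[LHS](subrK 1) cx1.
move/(congr1 (fun x => x - 1)); rewrite addrAC subrr add0r => /eqP.
by rewrite sqrf_eq0 => /eqP ->; rewrite ltxx.
Qed.

Lemma omega_prim (R : realType) n : (0 < n)%N -> n.-primitive_root (omega R n).
Proof.
move=> n0; apply/andP; split=> //; apply/forallP => i.
have n0R : 0 < n%:R :> R by rewrite ltr0n.
rewrite unity_rootE omegaX; apply/eqP.
have [->|ni] := eqVneq i.+1 n.
  rewrite -[_ *+ n]mulr_natr divfK ?(gt_eqF n0R)// mulr_natl cos2pi sin2pi.
  by rewrite eqxx.
have iln : (i.+1 < n)%N by rewrite ltn_neqAle ni ltn_ord.
apply/negbTE/eqP => -[c1 _]; move: c1; apply/eqP/cos_eq1_lt2pi.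
rewrite mulrn_wgt0 ?divr_gt0 ?mulr_gt0 ?pi_gt0//=.
rewrite -[_ *+ i.+1]mulr_natr mulrAC ltr_pdivrMr// ltr_pM2l ?ltr_nat//.
by rewrite mulr_gt0 ?pi_gt0.
Qed.

(** * The Fourier transform as a unitary change of basis *)

Lemma dot_mulmx_unitary (R : realType) n p (V : 'M[R[i]]_(n, p)) x y :
  V \is unitarymx -> dot (x *m V) (y *m V) = dot x y.
Proof.
by move=> Vu; rewrite /dot !dotmxE trmx_mul map_mxM mulmxA mulmxtVK.
Qed.

Section DiscreteFourier.
Variables (R : realType) (n : nat).
Hypothesis n_gt0 : (0 < n)%N.
Local Notation w := (omega R n).
Local Notation U := (fourier_mx n w).

Let w_prim : n.-primitive_root w := omega_prim R n_gt0.
Let U_unitary : U \is unitarymx := fourier_mx_unitary w_prim.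

Lemma idftE (x : 'rV[R[i]]_n) : idft x = x *m U.
Proof.
apply/rowP => i; rewrite !mxE mulr_sumr; apply: eq_bigr => k _.
by rewrite mxE mulrCA mulnC.
Qed.

Lemma dftE (x : 'rV[R[i]]_n) : dft x = x *m map_mx Num.conj U^T.
Proof.
have sn : (sqrtC n%:R : R[i])^-1 \is Num.real by rewrite rpredV sqrtC_real.
apply/rowP => k; rewrite !mxE mulr_sumr; apply: eq_bigr => i _.
rewrite !mxE [(_ * _)^*]rmorphM/= conj_Creal// mulrCA mulnC.
by rewrite exprnP (conj_prim_rootXz w_prim) -exprnN.
Qed.

Lemma dftK : cancel (@dft R n) idft.
Proof. by move=> x; rewrite idftE dftE mulmxKtV. Qed.

Lemma dot_idft (x y : 'rV[R[i]]_n) : dot (idft x) (idft y) = dot x y.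
Proof.
by rewrite !idftE dot_mulmx_unitary.
Qed.

Definition modulate (x : 'rV[R[i]]_n) (j : int) : 'rV[R[i]]_n :=
  \row_f (x 0 f * w ^ (- (j * f%:Z))).

(** Shift theorem; reducing the index modulo [n] is harmless because [w ^+ n = 1]. *)
Lemma shift_idft (x : 'rV[R[i]]_n) (j : int) :
  shift (idft x) j = idft (modulate x j).
Proof.
apply/rowP => i; rewrite shiftE !mxE; congr (_ * _).
apply: eq_bigr => f _; rewrite mxE -mulrA; congr (_ * _).
rewrite !exprnP -expfzDr ?(prim_root_neq0 w_prim)//.
apply: (prim_rootXz_mod w_prim).
by rewrite !PoszM index_modE modzMml mulrBl addrC.
Qed.

Lemma dft_std_basis (j : int) (k : 'I_n) :
  dft (std_basis j) 0 k = (sqrtC n%:R)^-1 * w ^ (- (j * k%:Z)).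
Proof.
rewrite mxE; congr (_ * _); rewrite (bigD1 (index_mod k j))//= big1 => [|i ij].
  rewrite addr0 mxE index_modE modz_mod eqxx mul1r exprnN.
  apply: (prim_rootXz_mod w_prim).
  by rewrite PoszM index_modE -!mulNr -modzMml modzNm modzMml.
rewrite mxE; case: eqP => [ij'|]; last by rewrite mul0r.
case/eqP: ij; apply/val_inj/eqP; rewrite -eqz_nat index_modE -ij'.
by rewrite modz_small ?ltz_nat ?ltn_ord.
Qed.

End DiscreteFourier.

(** * Frequency blocks, orthogonal projections and transport of maximisers *)

Lemma mem_coset_idx N s n t (i : 'I_n) : n = (N * s)%N -> (t < N)%N ->
  (i \in coset_idx N s t) = (i %% N == t)%N.
Proof.
move=> nE tN; rewrite inE; apply/existsP/eqP => [[l /eqP ->]|<-].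
  by rewrite addnC modnMDl modn_small.
have iN : (i %/ N < s)%N.
  by rewrite ltn_divLR ?(leq_ltn_trans _ tN)// mulnC -nE.
by exists (Ordinal iN); rewrite /= addnC -divn_eq.
Qed.

Lemma l2normE (R : realType) n (x : 'rV[R[i]]_n) : l2norm x ^+ 2 = dot x x.
Proof. exact: sqrtCK. Qed.

Lemma norm_proj (R : realType) n p (V : 'M[R[i]]_(p, n)) (x : 'rV[R[i]]_n) :
  V \is unitarymx ->
  l2norm (proj V x) ^+ 2 = \sum_(k < p) `|dot x (row k V)| ^+ 2.
Proof.
move=> Vu; rewrite l2normE /proj.
have -> : x *m proj_ortho V = x *m map_mx Num.conj V^T *m V.
  set a := x *m map_mx Num.conj V^T.
  (* Split [x] into [a *m V], in the row space of [V], and a remainder orthogonal to that space. *)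
  rewrite -[in LHS](subrK (a *m V) x) mulmxDl proj_ortho_0; last first.
    by rewrite orthomx1E mulmxBl mulmxtVK// subrr.
  by rewrite add0r proj_ortho_id// submxMl.
rewrite dot_mulmx_unitary// dotE; apply: eq_bigr => k _.
rewrite -normCK dotE mxE; congr (`|_| ^+ 2).
by apply: eq_bigr => i _; rewrite !mxE.
Qed.
(** The right inverse [psi] makes every competitor in [T'] an image under [phi], and a positive
    factor preserves the order of objectives. *)
Lemma is_argmax_transport (R : realType) (T T' : Type)
    (phi : T -> T') (psi : T' -> T) (D : T -> Prop) (D' : T' -> Prop)
    (f : T -> R[i]) (f' : T' -> R[i]) (c : R[i]) :
  cancel psi phi -> 0 < c -> (forall p, D' (phi p) <-> D p) ->
  (forall p, f' (phi p) = c * f p) ->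
  forall p, is_argmax D' f' (phi p) <-> is_argmax D f p.
Proof.
move=> psiK c0 DD ff p; split=> -[Dp pmax]; split=> //.
- exact/DD.
- by move=> q; rewrite -DD -(ler_pM2l c0) -!ff => /pmax.
- exact/DD.
- by move=> q; rewrite -(psiK q) => /DD/pmax; rewrite !ff ler_pM2l.
Qed.

(** * Inner products with shifts, block by block *)

Section Blocks.
Variables (R : realType) (N s n : nat).
Hypotheses (N_gt0 : (0 < N)%N) (s_gt0 : (0 < s)%N) (nE : n = (N * s)%N).
Local Notation w := (omega R n).
Local Notation u := (omega R n ^+ s).

Let n_gt0 : (0 < n)%N. Proof. by rewrite nE muln_gt0 N_gt0. Qed.
Let w_prim : n.-primitive_root w := omega_prim R n_gt0.
Let u_prim : N.-primitive_root u.
Proof.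
have <- : (n %/ N = s)%N by rewrite nE mulKn.
by apply: (dvdn_prim_root w_prim); rewrite nE dvdn_mulr.
Qed.

(** The quantity written g_t(a, z) above. *)
Definition block_dot (t : nat) (a z : 'rV[R[i]]_n) : R[i] :=
  \sum_(f in coset_idx N s t) a 0 f * (z 0 f)^*.

Lemma eq_block_dot t (a b z v : 'rV[R[i]]_n) :
  {in coset_idx N s t, forall f, a 0 f = b 0 f} ->
  {in coset_idx N s t, forall f, z 0 f = v 0 f} ->
  block_dot t a z = block_dot t b v.
Proof. by move=> ab zv; apply: eq_bigr => f ft; rewrite ab ?zv. Qed.

Lemma dot_blocks (a z : 'rV[R[i]]_n) :
  dot a z = \sum_(t < N) block_dot t a z.
Proof.
pose block (f : 'I_n) := Ordinal (ltn_pmod f N_gt0).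
rewrite dotE (partition_big block predT)//=.
apply: eq_bigr => t _; apply: eq_bigl => f.
by rewrite (mem_coset_idx _ nE).
Qed.

Lemma dot_restrict t (a z : 'rV[R[i]]_n) :
  dot (Defs.restrict (coset_idx N s t) a) z = block_dot t a z.
Proof.
rewrite dotE /block_dot [RHS]big_mkcond/=; apply: eq_bigr => f _.
by rewrite mxE; case: ifP => _ //; rewrite mul0r.
Qed.

(** As [f] is [t] modulo [N], [k s f] and [k s t] agree modulo [n = N s], so the phase is constant
    on the block. *)
Lemma modulateE (z : 'rV[R[i]]_n) (k : int) (t : 'I_N) :
  {in coset_idx N s t, forall f,
    modulate z (k * s%:Z) 0 f = z 0 f * u ^ (- (k * t%:Z))}.
Proof.
move=> f; rewrite (mem_coset_idx _ nE)// => /eqP ft.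
rewrite mxE; congr (_ * _); rewrite exprnP exprz_exp.
apply: (prim_rootXz_mod w_prim); apply/eqP; rewrite eqz_mod_dvd.
apply/dvdzP; exists (- (k * (f %/ N)%N%:Z)).
have -> : n%:Z = N%:Z * s%:Z by rewrite nE PoszM.
rewrite {1}(divn_eq f N) ft PoszD PoszM.
ring.
Qed.

Lemma block_dot_modulatel (a z : 'rV[R[i]]_n) (k : int) (t : 'I_N) :
  block_dot t (modulate a (k * s%:Z)) z = u ^ (- (k * t%:Z)) * block_dot t a z.
Proof.
rewrite mulr_sumr; apply: eq_bigr => f ft.
by rewrite (modulateE _ _ ft) mulrAC mulrC.
Qed.

Lemma block_dot_modulater (a z : 'rV[R[i]]_n) (k : int) (t : 'I_N) :
  block_dot t a (modulate z (k * s%:Z)) = u ^ (k * t%:Z) * block_dot t a z.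
Proof.
rewrite mulr_sumr; apply: eq_bigr => f ft.
rewrite (modulateE _ _ ft) [(_ * _)^*]rmorphM/= (conj_prim_rootXz u_prim) opprK.
by rewrite mulrA mulrC.
Qed.

Lemma dot_shift_idft (a z : 'rV[R[i]]_n) (k : int) :
  dot (idft a) (shift (idft z) (k * s%:Z)) =
  \sum_(t < N) u ^ (k * t%:Z) * block_dot t a z.
Proof.
rewrite shift_idft// dot_idft// dot_blocks.
by apply: eq_bigr => t _; rewrite block_dot_modulater.
Qed.

(** * The constraint and the projection norm in terms of blocks *)

Lemma quasicyclic_idftP (z : 'rV[R[i]]_n) :
  quasicyclic_shift_orthonormal s (idft z) <->
  forall t : 'I_N, block_dot t z z = N%:R^-1.
Proof.
have N0 : N%:R != 0 :> R[i] by rewrite pnatr_eq0 -lt0n.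
have sZ0 : s%:Z != 0 by rewrite eqz_nat -lt0n.
have dvdP (k : int) : (k * s%:Z == 0 %[mod n])%Z = (N%:Z %| k)%Z.
  by rewrite eqz_mod_dvd subr0 nE PoszM dvdz_mul2r.
split=> [[R0 Rk] t|c].
  (* Fourier inversion on Z/N isolates block [t]: after exchanging the sums, the sum over [k]
     vanishes unless [r = t]. *)
  have : \sum_(k < N) u ^ (- (k%:Z * t%:Z)) * autocorr (idft z) (k%:Z * s%:Z) =
      N%:R * block_dot t z z.
    under eq_bigr => k _.
      rewrite /autocorr dot_shift_idft mulr_sumr.
      under eq_bigr => r _.
        rewrite mulrA -expfzDr ?(prim_root_neq0 u_prim)//.
        rewrite addrC -mulrBr mulrC [k%:Z * _]mulrC.
        over.
      over.
    rewrite exchange_big/=; under eq_bigr => r _.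
      by rewrite -mulr_sumr (sum_prim_rootXz u_prim) ord_dvdz_sub; over.
    rewrite (bigD1 t)//= big1 ?addr0 ?eqxx ?mul1r 1?mulrC// => r /negPf ->.
    by rewrite mul0r mulr0.
  (* By shift-orthonormality only the term [k = 0] survives, and it equals 1. *)
  rewrite (bigD1 (Ordinal N_gt0))//= big1 => [|k k0].
    rewrite !mul0r oppr0 expr0z mul1r addr0 R0 => /(congr1 (fun x => N%:R^-1 * x)).
    by rewrite mulr1 mulKf.
  rewrite Rk ?mulr0// => /eqP; rewrite dvdP dvdzE/= gtnNdvd//.
  by rewrite lt0n.
(* Conversely, equal block norms leave a pure character sum. *)
have cE (k : int) : autocorr (idft z) (k * s%:Z) = (N%:Z %| k)%Z%:R.
  rewrite /autocorr dot_shift_idft.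
  under eq_bigr do rewrite c.
  by rewrite -mulr_suml (sum_prim_rootXz u_prim) mulfK.
split; first by have := cE 0; rewrite mul0r dvdz0.
by move=> k /eqP; rewrite dvdP cE => /negPf ->.
Qed.

(** Shifts [i] and [j] have as inner product the mean over [t] of [u ^ ((j - i) t)]. *)
Lemma shift_span_unitary (z : 'rV[R[i]]_n) :
  (forall t : 'I_N, block_dot t z z = N%:R^-1) ->
  shift_span N s (idft z) \is unitarymx.
Proof.
have N0 : N%:R != 0 :> R[i] by rewrite pnatr_eq0 -lt0n.
move=> c; apply/row_unitarymxP => i j; rewrite !rowK -/(dot _ _).
rewrite !shift_idft// dot_idft// dot_blocks.
under eq_bigr => t _.
  rewrite block_dot_modulatel block_dot_modulater c mulrA.
  rewrite -expfzDr ?(prim_root_neq0 u_prim)// addrC -mulrBl.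
  over.
by rewrite -mulr_suml (sum_prim_rootXz u_prim) mulfK// ord_dvdz_sub eq_sym.
Qed.

(** Up to the factor [sqrtC N], the coefficients on the orthonormal shifts are the inverse transform
    on Z/N of the block products; Parseval applies. *)
Lemma norm_proj_shift_span (a z : 'rV[R[i]]_n) :
  (forall t : 'I_N, block_dot t z z = N%:R^-1) ->
  l2norm (proj (shift_span N s (idft z)) (idft a)) ^+ 2 =
  \sum_(t < N) N%:R * `|block_dot t a z| ^+ 2.
Proof.
move=> c; rewrite norm_proj ?shift_span_unitary//.
pose g : 'rV[R[i]]_N := \row_t block_dot t a z.
have N0 : sqrtC N%:R != 0 :> R[i] by rewrite sqrtC_eq0 pnatr_eq0 -lt0n.
have normE : N%:R = `|sqrtC N%:R| ^+ 2 :> R[i].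
  by rewrite -normrX sqrtCK normr_nat.
transitivity (N%:R * dot (g *m fourier_mx N u) (g *m fourier_mx N u)).
  rewrite dotE mulr_sumr; apply: eq_bigr => k _.
  rewrite rowK dot_shift_idft -normCK [X in _ = X * _]normE -exprMn -normrM.
  rewrite !mxE mulr_sumr; congr (`|_| ^+ 2); apply: eq_bigr => t _.
  by rewrite !mxE [RHS]mulrCA mulVKf// mulrC (exprnP u) mulnC PoszM.
rewrite dot_mulmx_unitary ?fourier_mx_unitary// dotE mulr_sumr.
by apply: eq_bigr => t _; rewrite mxE -normCK.
Qed.

(** Up to [1 / sqrtC n], the transform of a shifted unit vector acts as a modulation, hence as a
    phase on the block. *)
Lemma dot_restrict_modulated (t : 'I_N) (a z : 'rV[R[i]]_n) (k : int) :
  dot (Defs.restrict (coset_idx N s t)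
         (pointwise a (dft (std_basis (k * s%:Z))))) z =
  (sqrtC n%:R)^-1 * (u ^ (- (k * t%:Z)) * block_dot t a z).
Proof.
rewrite dot_restrict -block_dot_modulatel mulr_sumr.
apply: eq_bigr => f _; rewrite mxE dft_std_basis// [modulate _ _ _ _]mxE.
by rewrite mulrCA !mulrA.
Qed.

(** The phases drop out, leaving [N] equal terms of weight [1 / n], and [N / n = 1 / s]. *)
Lemma sum_norm_dot_restrict_modulated (t : 'I_N) (a z : 'rV[R[i]]_n) :
  \sum_(j < N) `|dot (Defs.restrict (coset_idx N s t)
         (pointwise a (dft (std_basis (j%:Z * s%:Z))))) z| ^+ 2 =
  s%:R^-1 * `|block_dot t a z| ^+ 2.
Proof.
under eq_bigr => j _.
  rewrite dot_restrict_modulated !normrM normfV.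
  have -> : `|u ^ (- (j%:Z * t%:Z))| = 1.
    apply/eqP; rewrite -(@pexpr_eq1 _ _ 2)// normCK (conj_prim_rootXz u_prim).
    by rewrite -expfzDr ?(prim_root_neq0 u_prim)// opprK addNr expr0z.
  rewrite mul1r exprMn exprVn -normrX sqrtCK normr_nat.
  over.
rewrite sumr_const card_ord -[LHS]mulr_natl mulrA; congr (_ * _).
by rewrite nE natrM invfM mulVKf// pnatr_eq0 -lt0n.
Qed.

Lemma sum_norm_dot_restrict_scaled (t : 'I_N) (a z : 'rV[R[i]]_n) :
  \sum_(j < N) `|dot (Defs.restrict (coset_idx N s t)
         (sqrtC n%:R *: pointwise a (dft (std_basis (j%:Z * s%:Z))))) z| ^+ 2 =
  N%:R * `|block_dot t a z| ^+ 2.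
Proof.
have restrictZ A c (x : 'rV[R[i]]_n) :
      Defs.restrict A (c *: x) = c *: Defs.restrict A x.
  by apply/rowP => f; rewrite !mxE; case: ifP => // _; rewrite mulr0.
under eq_bigr => j _.
  rewrite restrictZ /dot linearZl_LR/= normrM exprMn -normrX sqrtCK normr_nat.
  rewrite -/(dot _ _).
  over.
rewrite -mulr_sumr sum_norm_dot_restrict_modulated mulrA; congr (_ * _).
by rewrite nE natrM mulfK// pnatr_eq0 -lt0n.
Qed.

(** * Block energies and the two forms of the block problem *)

Lemma block_dotZr t (c : R[i]) (a z : 'rV[R[i]]_n) :
  block_dot t a (c *: z) = c^* * block_dot t a z.
Proof.
rewrite mulr_sumr; apply: eq_bigr => f _.
by rewrite mxE [(_ * _)^*]rmorphM/= mulrCA.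
Qed.

Lemma block_dot_l2norm t (z : 'rV[R[i]]_n) :
  supported_on (coset_idx N s t) z -> block_dot t z z = l2norm z ^+ 2.
Proof.
move=> zt; rewrite l2normE -dot_restrict; congr dot.
by apply/rowP => f; rewrite mxE; case: ifPn => // /zt.
Qed.

(** Common core of both block objectives, which are [N] times and [1 / s] times this energy. *)
Definition block_energy m (t : nat) (y : 'I_m -> 'rV[R[i]]_n)
    (z : 'rV[R[i]]_n) : R[i] :=
  \sum_(i < m) `|block_dot t (dft (y i)) z| ^+ 2.

Lemma block_energyZ m t (y : 'I_m -> 'rV[R[i]]_n) c z :
  block_energy t y (c *: z) = `|c| ^+ 2 * block_energy t y z.
Proof.
rewrite /block_energy mulr_sumr; apply: eq_bigr => i _.
by rewrite block_dotZr normrM norm_conjC exprMn.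
Qed.

Lemma eq_block_energy m t (y : 'I_m -> 'rV[R[i]]_n) (z v : 'rV[R[i]]_n) :
  {in coset_idx N s t, forall f, z 0 f = v 0 f} ->
  block_energy t y z = block_energy t y v.
Proof.
move=> zv; apply: eq_bigr => i _.
by rewrite (eq_block_dot (fun _ _ => erefl) zv).
Qed.

Lemma block_argmaxE m (t : 'I_N) (y : 'I_m -> 'rV[R[i]]_n) q :
  block_argmax N s t y q <->
  is_argmax
    (fun q => supported_on (coset_idx N s t) q /\ l2norm q ^+ 2 = N%:R^-1)
    (block_energy t y) q.
Proof.
apply: (@is_argmax_transport _ _ _ id id _ _ _ _ N%:R) => //.
  by rewrite ltr0n.
move=> z; rewrite [RHS]mulr_sumr; apply: eq_bigr => i _.
exact: sum_norm_dot_restrict_scaled.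
Qed.

Lemma block_pcaE m (t : 'I_N) (y : 'I_m -> 'rV[R[i]]_n) p :
  block_pca N s t y p <->
  is_argmax
    (fun p => supported_on (coset_idx N s t) p /\ l2norm p ^+ 2 = 1)
    (block_energy t y) p.
Proof.
apply: (@is_argmax_transport _ _ _ id id _ _ _ _ s%:R^-1) => //.
  by rewrite invr_gt0 ltr0n.
move=> z; rewrite [RHS]mulr_sumr; apply: eq_bigr => i _.
exact: sum_norm_dot_restrict_modulated.
Qed.

(** Scaling by [1 / sqrtC N] carries one sphere onto the other and multiplies the quadratic energy
    by [1 / N]. *)
Lemma block_argmax_scale m (t : 'I_N) (y : 'I_m -> 'rV[R[i]]_n) p :
  block_argmax N s t y ((sqrtC N%:R)^-1 *: p) <-> block_pca N s t y p.
Proof.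
have N0 : N%:R != 0 :> R[i] by rewrite pnatr_eq0 -lt0n.
have rN0 : sqrtC N%:R != 0 :> R[i] by rewrite sqrtC_eq0.
have norm_rN : `|(sqrtC N%:R)^-1| ^+ 2 = N%:R^-1 :> R[i].
  by rewrite normfV exprVn -normrX sqrtCK normr_nat.
have l2normZ c (z : 'rV[R[i]]_n) :
    l2norm (c *: z) ^+ 2 = `|c| ^+ 2 * l2norm z ^+ 2.
  by rewrite !l2normE /dot linearZl_LR linearZr_LR/= mulrA normCK.
rewrite block_argmaxE block_pcaE.
apply: (@is_argmax_transport _ _ _ _ (fun q => sqrtC N%:R *: q) _ _ _ _
  N%:R^-1).
- exact: scalerK.
- by rewrite invr_gt0 ltr0n.
- move=> z; rewrite (l2normZ _ z) norm_rN; split=> -[sz nz]; split.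
  + move=> f /sz; rewrite mxE => /eqP.
    by rewrite mulf_eq0 invr_eq0 (negPf rN0) => /eqP.
  + by rewrite -[LHS](mulVKf N0) nz mulfV.
  + by move=> f /sz; rewrite mxE => ->; rewrite mulr0.
  + by rewrite nz mulr1.
- by move=> z; rewrite block_energyZ norm_rN.
Qed.

Lemma quasicyclic_objectiveE m (y : 'I_m -> 'rV[R[i]]_n) (z : 'rV[R[i]]_n) :
  (forall t : 'I_N, block_dot t z z = N%:R^-1) ->
  \sum_(i < m) l2norm (proj (shift_span N s (idft z)) (y i)) ^+ 2 =
  N%:R * \sum_(t < N) block_energy t y z.
Proof.
move=> c; rewrite exchange_big/= mulr_sumr; apply: eq_bigr => i _.
by rewrite -[y i in LHS](dftK n_gt0) norm_proj_shift_span// mulr_sumr.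
Qed.

End Blocks.

(** * Assembly of the block solutions *)

Theorem mainTheorem1 (R : realType) (N s m n : nat)
    (N_gt0 : (0 < N)%N) (s_gt0 : (0 < s)%N) (m_gt0 : (0 < m)%N)
    (nE : n = (N * s)%N)
    (y : 'I_m -> 'rV[R[i]]_n) (y_centred : \sum_(i < m) y i = 0) :
  (forall (t : 'I_N) (q : 'rV[R[i]]_n),
     block_argmax N s t y q <->
     exists p : 'rV[R[i]]_n,
       block_pca N s t y p /\ q = (sqrtC N%:R)^-1 *: p) /\
  (forall qhat : 'I_N -> 'rV[R[i]]_n,
     (forall t : 'I_N, block_argmax N s t y (qhat t)) ->
     first_quasicyclic_pc N s y (idft (\sum_(t < N) qhat t))).
Proof.
have n_gt0 : (0 < n)%N by rewrite nE muln_gt0 N_gt0.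
have rN0 : sqrtC N%:R != 0 :> R[i] by rewrite sqrtC_eq0 pnatr_eq0 -lt0n.
split=> [t q|qhat qhat_max].
  split=> [|[p [pmax ->]]].
    rewrite -[q in X in X -> _](scalerK rN0) => qmax.
    exists (sqrtC N%:R *: q); split; last exact: (esym (scalerK rN0 q)).
    exact: (block_argmax_scale N_gt0 s_gt0 nE _ _ _).1 qmax.
  exact: (block_argmax_scale N_gt0 s_gt0 nE _ _ _).2 pmax.
have {}qhat_max t := (block_argmaxE N_gt0 s_gt0 nE t y (qhat t)).1 (qhat_max t).
set z := \sum_(t < N) qhat t.
(* The blocks are disjoint, so the other summands vanish on block [t]. *)
have zE (t : 'I_N) : {in coset_idx N s t, forall f, z 0 f = qhat t 0 f}.
  move=> f; rewrite (mem_coset_idx _ nE)// => /eqP ft.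
  rewrite summxE (bigD1 t)//= big1 ?addr0// => r rt.
  have [[-> //]] := qhat_max r.
  by rewrite (mem_coset_idx _ nE)// ft eq_sym.
have cz (t : 'I_N) : block_dot N s t z z = N%:R^-1.
  rewrite (eq_block_dot (zE t) (zE t)).
  by have [[sq nq] _] := qhat_max t; rewrite block_dot_l2norm.
split; first exact/(quasicyclic_idftP N_gt0 s_gt0 nE).
(* Every competitor is the inverse transform of some [v]. *)
move=> q; rewrite -(dftK n_gt0 q); move: (dft q) => v {q}.
move=> /(quasicyclic_idftP N_gt0 s_gt0 nE) cv.
have objE := @quasicyclic_objectiveE R _ _ _ N_gt0 s_gt0 nE m y.
suff : N%:R * (\sum_(t < N) block_energy N s t y v) <=
    N%:R * \sum_(t < N) block_energy N s t y z.
  by rewrite -(objE v cv) -(objE z cz).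
apply: ler_wpM2l; first exact: ler0n.
apply: ler_sum => t _.
(* By [cv], the restriction of [v] to block [t] is feasible for the problem that [qhat t] solves. *)
set vt := Defs.restrict (coset_idx N s t) v.
have vtE : {in coset_idx N s t, forall f, v 0 f = vt 0 f}.
  by move=> f ft; rewrite mxE ft.
have svt : supported_on (coset_idx N s t) vt.
  by move=> f /negPf ft; rewrite mxE ft.
rewrite (eq_block_energy y (zE t)) (eq_block_energy y vtE).
apply: (qhat_max t).2; split=> //; rewrite -(block_dot_l2norm svt).
by rewrite -(eq_block_dot vtE vtE).
Qed.
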